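(* In the setting described in the context (a nonconvex standard polygonal escape minimizer $\gamma$ of length $L<D$, with its selected gap $FT$ placed on $y=0$ and with the line $x=Ay$ supporting its hull $H$), every path vertex $B$ of $\gamma$ lying on the supporting line $x=Ay$ satisfies $B\prec T$.
   Context: Put $\rho=\frac{301804}{625565}$, $A=\frac{547947}{301804}$, $b=\frac{197}{766}$, $D=\frac{82074390584}{84861020075}$, and let $\Delta=\{(x,y): y\ge0,\ x\ge Ay,\ x+by\le1\}$, a triangle (with $A+b=1/\rho$) congruent to $\operatorname{conv}\{(-c,0),(c,0),(0,s)\}$, $s=766/\sqrt{625565}$, $c=197/\sqrt{625565}$. A path is an escape path if no translated and rotated copy of it lies in the interior of $\Delta$. A polygonal path is standard if it is simple and its nonrepeated vertices are exactly the extreme vertices of its convex hull, each visited once; a hull edge not traversed by the path is a gap; a standard path is convex if its links follow one hull-boundary chain between its endpoints, nonconvex otherwise. $X\prec Y$ means $X$ is visited strictly before $Y$. Setting: $\gamma$ is a nonconvex standard polygonal escape path, length-minimal among polygonal escape paths with at most $N$ segments for some $N$, of length $L<D$. Its selected gap is a gap $FT$ with a hull vertex $M$ and $h>0$ such that, in suitable rigid coordinates, the hull $H=\operatorname{conv}\gamma$ lies in the strip $0\le y\le h$ (both boundary lines supporting it), $F=(x_F,0)$, $T=(x_T,0)$, $M=(x_M,h)$, $x_F\le x_T$, $F\prec M\prec T$, and $L\ge(1+\sqrt2)h$. The coordinates are translated horizontally so that the line $x=Ay$ supports $H$ with $H\subset\{x\ge Ay\}$. *)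

(* Defs.v *)
From mathcomp Require Import all_boot all_order all_algebra.
From mathcomp Require Import boolp classical_sets interval_inference.
From mathcomp Require Import reals topology normedtype convex.

Set Implicit Arguments.
Unset Strict Implicit.
Unset Printing Implicit Defensive.

Import Order.TTheory GRing.Theory Num.Theory.
Import numFieldNormedType.Exports.

Local Open Scope classical_set_scope.
Local Open Scope ring_scope.
Local Open Scope convex_scope.

(* Numerals too large for unary representation go through %N, where they are
   kept in decimal form, which ring, field and lra understand. *)
Definition Acst (R : realType) : R := 547947%N%:R / 301804%N%:R.
Definition bcst (R : realType) : R := 197 / 766.
Definition Dcst (R : realType) : R := 82074390584%N%:R / 84861020075%N%:R.

Section Plane.
Variable R : realType.
Local Notation plane := (R * R)%type.
Implicit Types (p q u : plane) (H : set plane) (s : seq plane).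

(* The norm that the library puts on a product is the sup norm, hence an
   explicit Euclidean distance. *)
Definition edist p q : R :=
  Num.sqrt ((p.1 - q.1) ^+ 2 + (p.2 - q.2) ^+ 2).

Definition dot u p : R := u.1 * p.1 + u.2 * p.2.

Definition direct_motion (f : plane -> plane) : Prop :=
  exists c d (t : plane), c ^+ 2 + d ^+ 2 = 1 /\
    forall p, f p = (c * p.1 - d * p.2 + t.1, d * p.1 + c * p.2 + t.2).

Definition rigid_motion (f : plane -> plane) : Prop :=
  direct_motion f \/ direct_motion (fun p => f (p.1, - p.2)).

Definition segment p q : set plane :=
  [set (p : convex_lmodType plane) <| t |> q | t in [set: {i01 R}]].

Definition conv_hull (X : set plane) : set plane :=
  smallest [set C | convex_set (C : set (convex_lmodType plane))] X.

Definition extreme_point H p : Prop :=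
  H p /\ forall q r (t : {i01 R}), H q -> H r -> 0 < t%:num < 1 ->
    p = (q : convex_lmodType plane) <| t |> r -> q = p /\ r = p.

(* The line {p | dot u p = c} supports H, which lies on the side of u. *)
Definition supports u (c : R) H : Prop :=
  (forall p, H p -> c <= dot u p) /\ (exists2 p, H p & dot u p = c).

Definition hull_edge H p q : Prop :=
  p <> q /\ exists u c, [/\ u <> 0, supports u c H &
    H `&` [set r | dot u r = c] = segment p q].

(* A polygonal path is given by the list of its vertices in order of visit.
   Lists of length at most 1 have an empty path_image, so they are never
   escape paths below. *)
Definition links s : seq (plane * plane) := zip s (behead s).

Definition path_image s : set plane :=
  \bigcup_(e in [set` links s]) segment e.1 e.2.

Definition path_length s : R := \sum_(e <- links s) edist e.1 e.2.

Definition path_hull s : set plane := conv_hull (path_image s).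

Definition precedes s p q : Prop :=
  [/\ p \in s, q \in s & (index p s < index q s)%N].

Definition simple_path s : Prop :=
  uniq s /\
  forall (i j : nat) p, (i < j)%N -> (j < size (links s))%N ->
    segment (nth 0 s i) (nth 0 s i.+1) p ->
    segment (nth 0 s j) (nth 0 s j.+1) p ->
    j = i.+1 /\ p = nth 0 s j.

Definition standard s : Prop :=
  simple_path s /\ forall p, p \in s <-> extreme_point (path_hull s) p.

Definition traversed s p q : Prop := (p, q) \in links s \/ (q, p) \in links s.

Definition gap s p q : Prop := hull_edge (path_hull s) p q /\ ~ traversed s p q.

(* As the vertices of a simple path are distinct, a sequence of consecutive
   hull edges between its endpoints never turns back: it is one of the two
   hull-boundary chains joining them. *)
Definition convex_standard s : Prop :=
  standard s /\
  forall e, e \in links s -> hull_edge (path_hull s) e.1 e.2.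

Definition nonconvex_standard s : Prop := standard s /\ ~ convex_standard s.

Definition Delta : set plane :=
  [set p | [/\ 0 <= p.2, Acst R * p.2 <= p.1 & p.1 + bcst R * p.2 <= 1]].

Definition escape_path s : Prop :=
  ~ exists2 f, direct_motion f & f @` path_image s `<=` interior Delta.

Definition escape_minimizer s : Prop :=
  escape_path s /\
  exists2 N, (size (links s) <= N)%N &
    forall s', escape_path s' -> (size (links s') <= N)%N ->
      path_length s <= path_length s'.

(* The gap FT of the path s, with hull vertex M and width h, in coordinates
   where it lies on y = 0 and the hull lies in the strip 0 <= y <= h. *)
Definition placed_selected_gap s (F T M : plane) (h : R) : Prop :=
  [/\ gap s F T,
      extreme_point (path_hull s) M,
      0 < h,
      supports (0, 1) 0 (path_hull s) /\ supports (0, -1) (- h) (path_hull s) &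
      [/\ [/\ F.2 = 0, T.2 = 0 & M.2 = h],
          F.1 <= T.1,
          precedes s F M,
          precedes s M T &
          (1 + Num.sqrt 2) * h <= path_length s]].

End Plane.

(* Main.v *)
From mathcomp Require Import interval_inference topology normedtype convex.
From mathcomp Require Import ring lra.
Require Import Defs.
From mathcomp Require Import all_boot all_order all_algebra.
From mathcomp Require Import boolp classical_sets reals.

(** Suppose that B lies on the line x = A y but is not visited before T.  If
    B = T, then T is the origin, and so is F, whose abscissa lies between 0 and
    that of T; but F and T are distinct.

    Otherwise the path visits F, M, T, B in this order.  Since it escapes, its
    hull cannot stay on the near side of the third side x + b y = 1 of the
    triangle: otherwise a small translation, composed with the reflection in
    the bisector of the apex if the coordinates reverse orientation, would put
    the path inside the open triangle ([escape_path_reaches]).  Hence the path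
    also has a vertex C with x + b y >= 1, and it is enough to show that a path
    in the strip of height h which visits F, M, T, B in this order, and C at
    some time, has length at least D ([late_contact_length]).

    Going from y = 0 up to M and back to y = 0 costs at least 2 h, and going
    between C and B costs at least 1 - (A + b) h horizontally.  When C comes
    first, or after T, these two costs add up to more than D, because
    (1 + sqrt 2) h < D bounds h.  When C comes between F and T, the trips up and
    down contribute to the horizontal motion as well, and the extremal path is
    the zigzag F, M = C, T = F, B with B at height h.  For horizontal offset d
    between T and M its length is
      2 sqrt (h^2 + d^2) + sqrt ((1 - (A + b) h - d)^2 + h^2),
    whose minimum over h and d is only about 10^-5 larger than D.  This minimum
    is bounded by duality: the displacement along a fixed unit vector never
    exceeds the length of a stretch of path ([displacement_le]), so a good
    choice of one unit vector per stretch makes the estimate linear. *)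

Import Order.TTheory GRing.Theory Num.Theory.
Import numFieldNormedType.Exports.

Local Open Scope ring_scope.

(** * Lengths of paths through prescribed vertices *)

Section Arclength.
Variable R : realType.
Local Notation plane := (R * R)%type.
Implicit Types (p q u : plane) (s : seq plane).

(** Cauchy-Schwarz, from Lagrange's identity. *)
Lemma dot_le_edist u p q : u.1 ^+ 2 + u.2 ^+ 2 <= 1 ->
  dot u q - dot u p <= edist p q.
Proof.
move=> u1; rewrite /edist /dot.
set x := p.1 - q.1; set y := p.2 - q.2.
have -> : u.1 * q.1 + u.2 * q.2 - (u.1 * p.1 + u.2 * p.2)
          = - (u.1 * x + u.2 * y) by rewrite /x /y; ring.
apply: (le_trans (ler_norm _)).
rewrite -sqrtr_sqr ler_sqrt; last by rewrite addr_ge0 ?sqr_ge0.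
have lagrange : (u.1 * x + u.2 * y) ^+ 2 =
  (u.1 ^+ 2 + u.2 ^+ 2) * (x ^+ 2 + y ^+ 2) - (u.1 * y - u.2 * x) ^+ 2 by ring.
have := sqr_ge0 (u.1 * y - u.2 * x).
have : (u.1 ^+ 2 + u.2 ^+ 2) * (x ^+ 2 + y ^+ 2) <= x ^+ 2 + y ^+ 2.
  by rewrite ler_piMl // addr_ge0 ?sqr_ge0.
rewrite sqrrN lagrange; lra.
Qed.

Definition arclength s (n : nat) : R :=
  \sum_(k < n) edist (nth 0 s k) (nth 0 s k.+1).

Lemma path_length_cons2 p q s :
  path_length (p :: q :: s) = edist p q + path_length (q :: s).
Proof. by rewrite /path_length /links /= big_cons. Qed.

Lemma path_length_arclength s : path_length s = arclength s (size s).-1.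
Proof.
elim: s => [|p [|q s] IHs]; try by rewrite /arclength /path_length big_nil big_ord0.
by rewrite path_length_cons2 IHs /arclength /= big_ord_recl.
Qed.

Lemma displacement_le_arclength u s i j : u.1 ^+ 2 + u.2 ^+ 2 <= 1 -> (i <= j)%N ->
  dot u (nth 0 s j) - dot u (nth 0 s i) <= arclength s j - arclength s i.
Proof.
move=> u1; elim: j => [|j IHj]; first by rewrite leqn0 => /eqP ->; rewrite !subrr.
rewrite leq_eqVlt => /predU1P[->|]; first by rewrite !subrr.
rewrite ltnS => /IHj; have := dot_le_edist u (nth 0 s j) (nth 0 s j.+1) u1.
rewrite /arclength big_ord_recr /=; lra.
Qed.

(** Every length estimate below is a sum of instances of this one, because its
    right side telescopes along the path. *)
Lemma displacement_le a b p q s : a ^+ 2 + b ^+ 2 <= 1 ->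
  p \in s -> q \in s -> (index p s <= index q s)%N ->
  a * (q.1 - p.1) + b * (q.2 - p.2)
  <= arclength s (index q s) - arclength s (index p s).
Proof.
move=> ab1 ps qs le_pq.
have := displacement_le_arclength (a, b) s _ _ ab1 le_pq.
rewrite !nth_index // /dot /=; lra.
Qed.

Lemma arclength_le s i j : (i <= j)%N -> arclength s i <= arclength s j.
Proof.
move=> le_ij; have := displacement_le_arclength (0, 0) s _ _ _ le_ij.
by rewrite /dot /= !mul0r addr0 subrr subr_ge0; apply; rewrite expr0n addr0.
Qed.

Lemma arclength_ge0 s n : 0 <= arclength s n.
Proof. by have := arclength_le s _ _ (leq0n n); rewrite {1}/arclength big_ord0. Qed.

Lemma arclength_le_path_length p s : p \in s ->
  arclength s (index p s) <= path_length s.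
Proof.
move=> ps; rewrite path_length_arclength; apply: arclength_le.
by move: ps; rewrite -index_mem; case: (size s).
Qed.

(** The position of C in the order of visit decides between the two estimates
    explained above. *)
Lemma late_contact_length s F M T B C h :
  precedes s F M -> precedes s M T -> precedes s T B -> C \in s ->
  F.2 = 0 -> T.2 = 0 -> M.2 = h -> F.1 <= T.1 ->
  B.1 = Acst R * B.2 -> B.2 <= h -> C.2 <= h -> 1 <= C.1 + bcst R * C.2 ->
  0 <= h <= 11 / 25 ->
  Dcst R <= path_length s.
Proof.
rewrite /Acst /bcst /Dcst.
move=> [Fs Ms FM] [_ Ts MT] [_ Bs TB] Cs F0 T0 Mh FT B_line Bh Ch C_far h_bd.
have start0 p := arclength_ge0 s (index p s).
have stop p := arclength_le_path_length p s.
(* The optimal directions for the zigzag are a on the way up, -a on the way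
   down and (- v1, v2) on the way back.  The condition 2 a1 = v1 leaves of the
   abscissae of F and T only the nonnegative term a1 (T.1 - F.1), and
   2 a2 + v2 >= (A + b) v1 makes the total coefficient of h nonnegative, so that
   the length is at least v1.  The optimum is irrational; these fractions
   approximate it closely enough that v1 >= D. *)
pose a1 : R := 162 / 335; pose a2 : R := 372 / 425.
pose v1 : R := 324 / 335; pose v2 : R := 46 / 181.
have ne : a1 ^+ 2 + a2 ^+ 2 <= 1 by rewrite /a1 /a2; lra.
have nw : (- a1) ^+ 2 + a2 ^+ 2 <= 1 by rewrite sqrrN.
have sw : (- a1) ^+ 2 + (- a2) ^+ 2 <= 1 by rewrite !sqrrN.
have se : a1 ^+ 2 + (- a2) ^+ 2 <= 1 by rewrite sqrrN.
have back : (- v1) ^+ 2 + v2 ^+ 2 <= 1 by rewrite sqrrN /v1 /v2; lra.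
have east : 1 ^+ 2 + 0 ^+ 2 <= 1 :> R by rewrite expr0n expr1n addr0.
have west : (- 1) ^+ 2 + 0 ^+ 2 <= 1 :> R by rewrite sqrrN.
have north : 0 ^+ 2 + 1 ^+ 2 <= 1 :> R by rewrite addrC.
have south : 0 ^+ 2 + (- 1) ^+ 2 <= 1 :> R by rewrite addrC sqrrN.
have lastB := stop _ Bs; have lastC := stop _ Cs.
have firstF := start0 F; have firstC := start0 C.
have climb a b ab1 := displacement_le a b F M s ab1 Fs Ms (ltnW FM).
have fall a b ab1 := displacement_le a b M T s ab1 Ms Ts (ltnW MT).
have return_ a b ab1 := displacement_le a b T B s ab1 Ts Bs (ltnW TB).
have climb1 := climb _ _ north; have fall1 := fall _ _ south.
have return1 := return_ _ _ west.
have [CF|/ltnW FC] := leqP (index C s) (index F s).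
  have := displacement_le _ _ C F s west Cs Fs CF; lra.
have [CM|/ltnW MC] := leqP (index C s) (index M s).
  (* The detour by C replaces M by C in the horizontal count: from C to M the
     direction is turned westwards. *)
  have := displacement_le _ _ F C s ne Fs Cs FC.
  have := displacement_le _ _ C M s nw Cs Ms CM.
  have := fall _ _ sw; have := return_ _ _ back.
  rewrite /a1 /a2 /v1 /v2; lra.
have [CT|/ltnW TC] := leqP (index C s) (index T s).
  have := climb _ _ ne.
  have := displacement_le _ _ M C s se Ms Cs MC.
  have := displacement_le _ _ C T s sw Cs Ts CT.
  have := return_ _ _ back.
  rewrite /a1 /a2 /v1 /v2; lra.
have [CB|/ltnW BC] := leqP (index C s) (index B s).
  have := displacement_le _ _ C B s west Cs Bs CB.
  have := arclength_le s _ _ TC; lra.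
have := displacement_le _ _ B C s east Bs Cs BC.
have := arclength_le s _ _ (ltnW TB); lra.
Qed.
End Arclength.

(** * Escape paths reach the far side of the triangle *)

Section Motions.
Local Open Scope classical_set_scope.
Local Open Scope ring_scope.
Variable R : realType.
Local Notation plane := (R * R)%type.
Implicit Types (p q : plane) (s : seq plane) (f g : plane -> plane).

Lemma conv_coords p q (t : {i01 R}) :
  (conv t (p : convex_lmodType plane) q : plane) =
  (t%:num * p.1 + (1 - t%:num) * q.1, t%:num * p.2 + (1 - t%:num) * q.2).
Proof. by []. Qed.

(** The sign e, that of the determinant, treats both orientations at once. *)
Lemma rigid_motion_coords g : rigid_motion g ->
  exists c d e t1 t2 : R, [/\ c ^+ 2 + d ^+ 2 = 1, e = 1 \/ e = -1 &
    forall p, g p = (c * p.1 - d * e * p.2 + t1, d * p.1 + c * e * p.2 + t2)].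
Proof.
case=> -[c [d [t [cd gE]]]]; exists c, d.
  exists 1, t.1, t.2; split=> //; first by left.
  by move=> p; rewrite gE !mulr1.
exists (-1), t.1, t.2; split=> //; first by right.
move=> p; have := gE (p.1, - p.2).
by rewrite /= opprK -surjective_pairing => ->; congr (_, _); ring.
Qed.

Lemma edist_rigid g p q : rigid_motion g -> edist (g p) (g q) = edist p q.
Proof.
move=> /rigid_motion_coords[c [d [e [t1 [t2 [cd e1 gE]]]]]].
rewrite /edist !gE /=; congr (Num.sqrt _).
rewrite -[RHS]mul1r -cd; case: e1 => ->; ring.
Qed.

Lemma path_length_rigid g s : rigid_motion g ->
  path_length (map g s) = path_length s.
Proof.
move=> g_rigid; elim: s => [|p [|q s] IHs]; try by rewrite /path_length !big_nil.
by move: IHs; rewrite /= !path_length_cons2 => ->; rewrite edist_rigid.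
Qed.

Lemma mem_links e s : e \in links s -> e.1 \in s /\ e.2 \in s.
Proof.
elim: s => [|p [|q s] IHs] //; rewrite in_cons => /predU1P[->|/IHs[e1s e2s]].
  by rewrite /= !inE !eqxx orbT.
by split; rewrite in_cons (e1s, e2s) orbT.
Qed.

Lemma links_mem p s : p \in s -> (1 < size s)%N ->
  exists2 e, e \in links s & p = e.1 \/ p = e.2.
Proof.
elim: s => [|x [|y s] IHs] //; rewrite in_cons => /predU1P[->|ps] _.
  by exists (x, y); [rewrite mem_head | left].
case: s ps IHs => [|z s] ps IHs.
  by exists (x, y); [rewrite mem_head | right; move: ps; rewrite inE => /eqP].
have [//|e es pe] := IHs ps _.
by exists e => //; rewrite in_cons es orbT.
Qed.

Lemma vertex_path_hull p s : p \in s -> (1 < size s)%N -> path_hull s p.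
Proof.
move=> ps s1; apply: sub_smallest (fun _ => id) _ _.
have [e es pe] := links_mem _ _ ps s1.
exists e => //; case: pe => ->.
  by exists 1%:i01 => //; rewrite conv1.
by exists 0%:i01 => //; rewrite conv0.
Qed.

Definition open_Delta : set plane :=
  [set p | [/\ 0 < p.2, 0 < p.1 - Acst R * p.2 & 0 < 1 - (p.1 + bcst R * p.2)]].

Lemma open_Delta_interior : open_Delta `<=` interior (@Delta R).
Proof.
move=> p [p2 pA pb].
have c1 : (fun q : plane => q.1) @ p --> p.1 by exact: cvg_fst.
have c2 : (fun q : plane => q.2) @ p --> p.2 by exact: cvg_snd.
have cA : (fun q : plane => q.1 - Acst R * q.2) @ p --> p.1 - Acst R * p.2.
  by apply: cvgB => //; apply: cvgMl_tmp.
have cb : (fun q : plane => 1 - (q.1 + bcst R * q.2)) @ p --> 1 - (p.1 + bcst R * p.2).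
  by apply: cvgB; [exact: cvg_cst | apply: cvgD => //; apply: cvgMl_tmp].
rewrite /interior /=; near=> q; split.
- by apply: ltW; near: q; exact: (cvgr_gt _ c2).
- rewrite -subr_ge0; apply: ltW; near: q; exact: (cvgr_gt _ cA).
- rewrite -subr_ge0; apply: ltW; near: q; exact: (cvgr_gt _ cb).
Unshelve. all: by end_near. Qed.

Lemma motion_image_open_Delta f s : direct_motion f ->
  (forall p, p \in s -> open_Delta (f p)) -> f @` path_image s `<=` open_Delta.
Proof.
move=> [c [d [t [_ fE]]]] fs _ [p [e /mem_links[e1s e2s] [w _ <-]] <-].
have [y1 A1 b1] := fs _ e1s; have [y2 A2 b2] := fs _ e2s.
have -> : f (conv w (e.1 : convex_lmodType plane) e.2 : plane) =
    (w%:num * (f e.1).1 + (1 - w%:num) * (f e.2).1,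
     w%:num * (f e.1).2 + (1 - w%:num) * (f e.2).2).
  by rewrite !fE conv_coords /=; congr (_, _); ring.
split=> /=.
- exact: (convR_gt0 w y1 y2).
- by rewrite (_ : _ - _ = w%:num * ((f e.1).1 - Acst R * (f e.1).2) +
    (1 - w%:num) * ((f e.2).1 - Acst R * (f e.2).2));
    [exact: (convR_gt0 w A1 A2) | ring].
- by rewrite (_ : 1 - _ = w%:num * (1 - ((f e.1).1 + bcst R * (f e.1).2)) +
    (1 - w%:num) * (1 - ((f e.2).1 + bcst R * (f e.2).2)));
    [exact: (convR_gt0 w b1 b2) | ring].
Qed.

(** The triangle is isosceles with its apex at the origin, since
    1 + A^2 = (A + b)^2: these are the sine and cosine of the apex angle. *)
Definition apex_sin : R := 301804%N%:R / 625565%N%:R.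
Definition apex_cos : R := 547947%N%:R / 625565%N%:R.

Definition bisector_reflection p : plane :=
  (apex_cos * p.1 + apex_sin * p.2, apex_sin * p.1 - apex_cos * p.2).

Lemma open_Delta_reflection p : open_Delta p -> open_Delta (bisector_reflection p).
Proof.
move=> [p2 pA pb]; split=> /=; move: p2 pA pb;
  rewrite /Acst /bcst /apex_cos /apex_sin; lra.
Qed.

Lemma uniform_slack (k : plane -> R) s : (forall p, p \in s -> k p < 1) ->
  exists2 delta, 0 < delta & forall p, p \in s -> k p + delta < 1.
Proof.
elim: s => [|x s IHs] ks; first by exists 1.
have [p ps|delta d0 sd] := IHs; first by apply: ks; rewrite in_cons ps orbT.
have kx : k x < 1 by apply: ks; exact: mem_head.
exists (Num.min delta ((1 - k x) / 2)) => [|p].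
  by rewrite lt_min d0 /=; lra.
have md : Num.min delta ((1 - k x) / 2) <= delta by rewrite ge_min lexx.
have mx : Num.min delta ((1 - k x) / 2) <= (1 - k x) / 2.
  by rewrite ge_min lexx orbT.
rewrite in_cons => /predU1P[->|/sd]; lra.
Qed.

(** A path in the angle at the apex that stays away from the third side leaves
    some room there, as it has finitely many vertices; translating it by a
    quarter of this room along (A + 1, 1), where A + 1 + b < 4, moves it off the
    two sides of the angle without using up the room. *)
Lemma escape_path_reaches s g : rigid_motion g -> escape_path s ->
  (forall p, p \in map g s -> 0 <= p.2 /\ Acst R * p.2 <= p.1) ->
  exists2 C, C \in map g s & 1 <= C.1 + bcst R * C.2.
Proof.
move=> g_rigid s_escape wedge.
have [/hasP[C Cs C_far]|/hasPn near] :=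
  boolP (has (fun C : plane => 1 <= C.1 + bcst R * C.2) (map g s)).
  by exists C.
have [p /near|delta d0 slack] :=
  uniform_slack (fun p => p.1 + bcst R * p.2) (map g s).
  by rewrite -ltNge.
pose tau p : plane := (p.1 + (Acst R + 1) * (delta / 4), p.2 + delta / 4).
have tau_in p : p \in s -> open_Delta (tau (g p)).
  move=> ps; have gps : g p \in map g s by exact: map_f.
  have [] := wedge _ gps; have := slack _ gps.
  rewrite /open_Delta /tau => gps_slack gps2 gpsA.
  by split=> /=; move: gps_slack gps2 gpsA; rewrite /Acst /bcst; lra.
suff [f f_direct f_in] : exists2 f, direct_motion f &
    forall p, p \in s -> open_Delta (f p).
  case: s_escape; exists f => //.
  exact: subset_trans (motion_image_open_Delta _ _ f_direct f_in) open_Delta_interior.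
have [c [d [e [t1 [t2 [cd [] e1 gE]]]]]] := rigid_motion_coords g g_rigid.
  exists (tau \o g) => //; exists c, d, (tau (t1, t2)); split=> // p.
  by rewrite /tau /= gE e1 /=; congr (_, _); ring.
(* If g reverses orientation, the reflection makes the motion direct again and
   preserves the triangle. *)
exists (bisector_reflection \o tau \o g); last first.
  by move=> p /tau_in; exact: open_Delta_reflection.
exists (apex_cos * c + apex_sin * d), (apex_sin * c - apex_cos * d),
  (bisector_reflection (tau (t1, t2))); split=> [|p].
  transitivity ((apex_cos ^+ 2 + apex_sin ^+ 2) * (c ^+ 2 + d ^+ 2)); first by ring.
  by rewrite cd mulr1 /apex_cos /apex_sin; field.
by rewrite /bisector_reflection /tau /= gE e1 /=; congr (_, _); ring.
Qed.
End Motions.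

(** * Vertices on the supporting line are visited before T *)

(** The value 11/25 is not sharp: the crude estimate needs
    1 + 2 h - (A + b) h >= D, that is h < 0.45 or so. *)
Lemma strip_height_le (R : realType) (h : R) :
  0 <= h -> (1 + Num.sqrt 2) * h < Dcst R -> h <= 11 / 25.
Proof.
move=> h0; have sqrt2 : 6 / 5 <= Num.sqrt 2 :> R.
  have -> : 6 / 5 = Num.sqrt ((6 / 5) ^+ 2) :> R.
    by rewrite sqrtr_sqr ger0_norm //; lra.
  by rewrite ler_sqrt; lra.
have : (1 + 6 / 5) * h <= (1 + Num.sqrt 2) * h by rewrite ler_wpM2r // lerD2l.
rewrite /Dcst; lra.
Qed.

Theorem proposition4p3 (R : realType) (gamma : seq (R * R))
    (g : R * R -> R * R) (F T M : R * R) (h : R)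
    (gamma_standard : nonconvex_standard gamma)
    (gamma_minimizer : escape_minimizer gamma)
    (gamma_short : path_length gamma < Dcst R)
    (g_rigid : rigid_motion g)
    (gap_FT : placed_selected_gap (map g gamma) F T M h)
    (line_supports : supports (1, - Acst R) 0 (path_hull (map g gamma))) :
  forall B : R * R, B \in map g gamma -> B.1 = Acst R * B.2 ->
    precedes (map g gamma) B T.
Proof.
move=> B Bs B_line.
have {gamma_minimizer} [gamma_escape _] := gamma_minimizer.
have len := path_length_rigid R g gamma g_rigid.
move: gap_FT => [[[FT_neq _] _] _ h0 [[floor _] [ceiling _]]
  [[F0 T0 Mh] FT FM MT h_le]].
have [Fs Ms FM_lt] := FM; have [_ Ts MT_lt] := MT.
have s1 : (1 < size (map g gamma))%N.
  have := Ts; rewrite -index_mem; apply: leq_trans.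
  by rewrite ltnS; exact: leq_ltn_trans MT_lt.
have in_strip p : p \in map g gamma -> 0 <= p.2 <= h.
  move=> /vertex_path_hull/(_ s1) pH; apply/andP; split.
    by have := floor _ pH; rewrite /dot /=; lra.
  by have := ceiling _ pH; rewrite /dot /=; lra.
have in_wedge p : p \in map g gamma -> Acst R * p.2 <= p.1.
  move=> /vertex_path_hull/(_ s1) pH.
  by have := line_supports.1 _ pH; rewrite /dot /=; lra.
split=> //; rewrite ltnNge; apply/negP; rewrite leq_eqVlt => /orP[/eqP TB|TB].
  have {}TB : T = B.
    by rewrite -(nth_index 0 Ts) TB nth_index.
  apply: FT_neq; have := in_wedge _ Fs; rewrite F0 mulr0 => F1.
  have T1 : T.1 = 0 by rewrite TB B_line -TB T0 mulr0.
  rewrite (surjective_pairing F) (surjective_pairing T) F0 T0 T1.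
  by congr (_, _); apply/eqP; rewrite eq_le F1 -T1 FT.
have wedge p : p \in map g gamma -> 0 <= p.2 /\ Acst R * p.2 <= p.1.
  by move=> ps; split; [have /andP[] := in_strip _ ps | exact: in_wedge].
have [C Cs C_far] := escape_path_reaches _ _ _ g_rigid gamma_escape wedge.
have h_small : 0 <= h <= 11 / 25.
  apply/andP; split; first exact: ltW.
  apply: strip_height_le; first exact: ltW.
  by rewrite -len in gamma_short; exact: le_lt_trans gamma_short.
have := late_contact_length R (map g gamma) F M T B C h FM MT (And3 Ts Bs TB) Cs
  F0 T0 Mh FT B_line _ _ C_far h_small.
have /andP[_ Bh] := in_strip _ Bs; have /andP[_ Ch] := in_strip _ Cs.
by rewrite len => /(_ Bh Ch)/(lt_le_trans gamma_short); rewrite ltxx.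
Qed.
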